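(* Let $f:[a,b]_{q,\omega}\times\mathbb{R}\times\mathbb{R}\to\mathbb{R}$ satisfy the standing assumptions listed in the context, let $\alpha,\beta\in\mathbb{R}$, and consider the problem of minimizing or maximizing $$\mathcal{L}[y]=\int_a^b f(t,y(qt+\omega),D_{q,\omega}y(t))\,d_{q,\omega}t$$ over all $y\in\mathbb{E}$ with $y(a)=\alpha$ and $y(b)=\beta$. Suppose that $\tilde y$ is a local minimizer or a local maximizer of this problem. Then $$D_{q,\omega}\,\partial_3 f(t,\tilde y(qt+\omega),D_{q,\omega}\tilde y(t))=\partial_2 f(t,\tilde y(qt+\omega),D_{q,\omega}\tilde y(t))$$ for all $t\in[a,b]_{q,\omega}$, where the left-hand side is the $q,\omega$-derivative of the function $t\mapsto\partial_3 f(t,\tilde y(qt+\omega),D_{q,\omega}\tilde y(t))$.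
   Context: Let $q\in(0,1)$ and $\omega>0$ be fixed, $\omega_0:=\frac{\omega}{1-q}$, and let $I\subseteq\mathbb{R}$ be a closed interval containing $\omega_0$; let $a,b\in I$ with $a<b$. For $k\in\mathbb{N}_0=\{0,1,2,\dots\}$ put $[k]_{q,\omega}:=\frac{\omega(1-q^k)}{1-q}$. Set $$[a,b]_{q,\omega}:=\{q^na+[n]_{q,\omega}:n\in\mathbb{N}_0\}\cup\{q^nb+[n]_{q,\omega}:n\in\mathbb{N}_0\}\cup\{\omega_0\},\qquad [s]_{q,\omega}:=\{q^ns+[n]_{q,\omega}:n\in\mathbb{N}_0\}\cup\{\omega_0\}\ (s\in I).$$ Hahn derivative: $D_{q,\omega}f(t):=\frac{f(qt+\omega)-f(t)}{(qt+\omega)-t}$ if $t\ne\omega_0$, and $D_{q,\omega}f(\omega_0):=f'(\omega_0)$, provided $f$ is differentiable at $\omega_0$. For functions on $[a,b]_{q,\omega}$ the same formula is used (the derivative at $\omega_0$ being taken along $[a,b]_{q,\omega}$). Jackson–Nörlund integral: $\int_{\omega_0}^{x}f(t)\,d_{q,\omega}t:=(x(1-q)-\omega)\sum_{k=0}^{\infty}q^kf(xq^k+[k]_{q,\omega})$ and $\int_a^b f\,d_{q,\omega}t:=\int_{\omega_0}^b f\,d_{q,\omega}t-\int_{\omega_0}^a f\,d_{q,\omega}t$, provided the series converge at $x=a$ and $x=b$. $\mathcal{D}$ is the set of all functions $[a,b]_{q,\omega}\to\mathbb{R}$ continuous at $\omega_0$. $\mathbb{E}$ is the linear space of $y\in\mathcal{D}$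 whose $q,\omega$-derivative is bounded on $[a,b]_{q,\omega}$ and continuous at $\omega_0$, with norm $\|y\|_1=\sup_{t\in[a,b]_{q,\omega}}|y(t)|+\sup_{t\in[a,b]_{q,\omega}}|D_{q,\omega}y(t)|$. A function $y\in\mathbb{E}$ is admissible if $y(a)=\alpha$, $y(b)=\beta$; $h\in\mathbb{E}$ is an admissible variation if $h(a)=h(b)=0$. An admissible $\tilde y$ is a local minimizer (resp. maximizer) if there is $\delta>0$ with $\mathcal{L}[\tilde y]\le\mathcal{L}[y]$ (resp. $\ge$) for all admissible $y$ with $\|y-\tilde y\|_1<\delta$. $\partial_2f,\partial_3f$ are the partial derivatives of $f$ in its second and third arguments. A function $g(t,\cdot)$ is differentiable at $\theta_0$ uniformly in $t\in[s]_{q,\omega}$ if for every $\varepsilon>0$ there is $\delta>0$ such that $0<|\theta-\theta_0|<\delta$ implies $\left|\frac{g(t,\theta)-g(t,\theta_0)}{\theta-\theta_0}-\partial_2g(t,\theta_0)\right|<\varepsilon$ for all $t\in[s]_{q,\omega}$, where $\partial_2 g=\partial g/\partial\theta$. Standing assumptions on $f$: (1) $(u,v)\mapsto f(t,u,v)$ is $C^1(\mathbb{R}^2,\mathbb{R})$ for every $t\in[a,b]_{q,\omega}$; (2) for every admissible $y$, the functions $f(\cdot,y(\cdot),D_{q,\omega}y(\cdot))$, $\partial_2f(\cdot,y(\cdot),D_{q,\omega}y(\cdot))$, $\partial_3f(\cdot,y(\cdot),D_{q,\omega}y(\cdot))$ are continuous at $\omega_0$; (3) for every admissible $y$ and admissible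 variation $h$, the function $g(t,\varepsilon)=f(t,y(qt+\omega)+\varepsilon h(qt+\omega),D_{q,\omega}y(t)+\varepsilon D_{q,\omega}h(t))$, defined for $\varepsilon$ in some interval $]-\bar\varepsilon,\bar\varepsilon[$, is such that $g(t,\cdot)$ is differentiable at $0$ uniformly in $t\in[a]_{q,\omega}$ and uniformly in $t\in[b]_{q,\omega}$, the integrals $\int_{\omega_0}^a g(t,\varepsilon)\,d_{q,\omega}t$ and $\int_{\omega_0}^b g(t,\varepsilon)\,d_{q,\omega}t$ exist for $\varepsilon$ near $0$, and $\int_{\omega_0}^a\partial_2g(t,0)\,d_{q,\omega}t$ and $\int_{\omega_0}^b\partial_2g(t,0)\,d_{q,\omega}t$ exist.
   Formalization: Adds that neither a nor b lies on the other's forward orbit under t -> qt+ω, and takes standing assumption (2) as continuity at ω₀ of f, ∂₂f, ∂₃f along (t, y(qt+ω), D y(t)) instead of (t, y(t), D y(t)); without either change the claim is false. *)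

(* Defs.v *)
From Stdlib Require Import Reals Lra.
From Coquelicot Require Import Coquelicot.

Open Scope R_scope.

(* Functions on [a,b]_{q,w} are represented by total functions R -> R; every
   notion below depends only on their values on [a,b]_{q,w}. *)

Definition omega0 (q w : R) : R := w / (1 - q).

Definition qw_bracket (q w : R) (k : nat) : R := w * (1 - q ^ k) / (1 - q).

Definition qw_iter (q w : R) (n : nat) (s : R) : R := q ^ n * s + qw_bracket q w n.

Definition qw_orbit (q w s : R) (t : R) : Prop :=
  (exists n : nat, t = qw_iter q w n s) \/ t = omega0 q w.

Definition qw_interval (q w a b : R) (t : R) : Prop :=
  (exists n : nat, t = qw_iter q w n a) \/
  (exists n : nat, t = qw_iter q w n b) \/
  t = omega0 q w.

Definition closed_interval (I : R -> Prop) : Prop :=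
  closed I /\ (forall x y z : R, I x -> I y -> x <= z <= y -> I z).

Definition continuous_on_at (S : R -> Prop) (y : R -> R) (x : R) : Prop :=
  filterlim y (within S (locally x)) (locally (y x)).

Definition is_derive_on (S : R -> Prop) (y : R -> R) (x l : R) : Prop :=
  filterlim (fun t => (y t - y x) / (t - x)) (within S (locally' x)) (locally l).

Definition is_hahn_derive (q w : R) (S : R -> Prop) (y : R -> R) (t l : R) : Prop :=
  (t <> omega0 q w -> l = (y (q * t + w) - y t) / ((q * t + w) - t)) /\
  (t = omega0 q w -> is_derive_on S y (omega0 q w) l).

Definition ex_hahn_derive (q w : R) (S : R -> Prop) (y : R -> R) (t : R) : Prop :=
  exists l : R, is_hahn_derive q w S y t l.

(* At omega0 the value is unspecified when y is not differentiable there;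
   statements using it pair it with ex_hahn_derive. *)
Definition hahn_derive (q w : R) (S : R -> Prop) (y : R -> R) (t : R) : R :=
  if Req_EM_T t (omega0 q w)
  then iota (fun l : R => is_derive_on S y (omega0 q w) l)
  else (y (q * t + w) - y t) / ((q * t + w) - t).

Definition ex_jn_int0 (q w : R) (F : R -> R) (x : R) : Prop :=
  ex_series (fun k : nat => q ^ k * F (x * q ^ k + qw_bracket q w k)).

Definition jn_int0 (q w : R) (F : R -> R) (x : R) : R :=
  (x * (1 - q) - w) *
  Series (fun k : nat => q ^ k * F (x * q ^ k + qw_bracket q w k)).

Definition jn_int (q w : R) (F : R -> R) (a b : R) : R :=
  jn_int0 q w F b - jn_int0 q w F a.

Definition in_D (q w a b : R) (y : R -> R) : Prop :=
  continuous_on_at (qw_interval q w a b) y (omega0 q w).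

Definition in_E (q w a b : R) (y : R -> R) : Prop :=
  let S := qw_interval q w a b in
  in_D q w a b y /\
  ex_hahn_derive q w S y (omega0 q w) /\
  (exists M : R, forall t : R, S t -> Rabs (hahn_derive q w S y t) <= M) /\
  continuous_on_at S (hahn_derive q w S y) (omega0 q w).

Definition sup_on (S : R -> Prop) (y : R -> R) : Rbar :=
  Lub_Rbar (fun r : R => exists t : R, S t /\ r = Rabs (y t)).

Definition norm1 (q w a b : R) (y : R -> R) : Rbar :=
  let S := qw_interval q w a b in
  Rbar_plus (sup_on S y) (sup_on S (hahn_derive q w S y)).

Definition admissible (q w a b alpha beta : R) (y : R -> R) : Prop :=
  in_E q w a b y /\ y a = alpha /\ y b = beta.

Definition admissible_variation (q w a b : R) (h : R -> R) : Prop :=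
  in_E q w a b h /\ h a = 0 /\ h b = 0.

Definition partial2 (f : R -> R -> R -> R) (t u v : R) : R :=
  Derive (fun x : R => f t x v) u.

Definition partial3 (f : R -> R -> R -> R) (t u v : R) : R :=
  Derive (fun x : R => f t u x) v.

(* t |-> F(t, y(qt + w), D_{q,w} y(t)) *)
Definition along (q w a b : R) (F : R -> R -> R -> R) (y : R -> R) (t : R) : R :=
  F t (y (q * t + w)) (hahn_derive q w (qw_interval q w a b) y t).

Definition functional (q w a b : R) (f : R -> R -> R -> R) (y : R -> R) : R :=
  jn_int q w (along q w a b f y) a b.

Definition C1_R2 (g : R -> R -> R) : Prop :=
  (forall u v : R, ex_derive (fun x => g x v) u /\ ex_derive (fun x => g u x) v) /\
  (forall p : R * R,
     continuous (fun p : R * R => Derive (fun x => g x (snd p)) (fst p)) p /\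
     continuous (fun p : R * R => Derive (fun x => g (fst p) x) (snd p)) p).

Definition unif_differentiable_at
    (g : R -> R -> R) (theta0 : R) (S : R -> Prop) : Prop :=
  (forall t : R, S t -> ex_derive (g t) theta0) /\
  (forall eps : posreal, exists delta : posreal,
     forall theta : R, 0 < Rabs (theta - theta0) < delta ->
     forall t : R, S t ->
       Rabs ((g t theta - g t theta0) / (theta - theta0) - Derive (g t) theta0) < eps).

Definition variation_fun (q w a b : R) (f : R -> R -> R -> R)
    (y h : R -> R) (t eps : R) : R :=
  let S := qw_interval q w a b in
  f t (y (q * t + w) + eps * h (q * t + w))
      (hahn_derive q w S y t + eps * hahn_derive q w S h t).

Definition assumption1 (q w a b : R) (f : R -> R -> R -> R) : Prop :=
  forall t : R, qw_interval q w a b t -> C1_R2 (f t).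

(* Continuity is required along the argument (t, y(qt + w), D_{q,w} y(t)) at
   which f and its partial derivatives occur in the functional and in the
   Euler-Lagrange equation. *)
Definition assumption2 (q w a b alpha beta : R) (f : R -> R -> R -> R) : Prop :=
  forall y : R -> R, admissible q w a b alpha beta y ->
    let cont := fun F : R -> R -> R -> R =>
      continuous_on_at (qw_interval q w a b) (along q w a b F y) (omega0 q w) in
    cont f /\ cont (partial2 f) /\ cont (partial3 f).

Definition assumption3 (q w a b alpha beta : R) (f : R -> R -> R -> R) : Prop :=
  forall y h : R -> R,
    admissible q w a b alpha beta y -> admissible_variation q w a b h ->
    let g := variation_fun q w a b f y h in
    unif_differentiable_at g 0 (qw_orbit q w a) /\
    unif_differentiable_at g 0 (qw_orbit q w b) /\
    locally 0 (fun eps : R =>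
      ex_jn_int0 q w (fun t => g t eps) a /\ ex_jn_int0 q w (fun t => g t eps) b) /\
    ex_jn_int0 q w (fun t => Derive (g t) 0) a /\
    ex_jn_int0 q w (fun t => Derive (g t) 0) b.

Definition local_minimizer (q w a b alpha beta : R) (f : R -> R -> R -> R)
    (ytil : R -> R) : Prop :=
  admissible q w a b alpha beta ytil /\
  exists delta : posreal, forall y : R -> R,
    admissible q w a b alpha beta y ->
    Rbar_lt (norm1 q w a b (fun t => y t - ytil t)) delta ->
    functional q w a b f ytil <= functional q w a b f y.

Definition local_maximizer (q w a b alpha beta : R) (f : R -> R -> R -> R)
    (ytil : R -> R) : Prop :=
  admissible q w a b alpha beta ytil /\
  exists delta : posreal, forall y : R -> R,
    admissible q w a b alpha beta y ->
    Rbar_lt (norm1 q w a b (fun t => y t - ytil t)) delta ->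
    functional q w a b f ytil >= functional q w a b f y.

(* a and b generate different orbits of t |-> qt + w.  If, say, a = qb + w, then
   int_a^b is a single term depending on y only through y(a) and y(b), so that
   every admissible y is a minimizer whether or not it satisfies the
   Euler-Lagrange equation. *)
Definition distinct_orbits (q w a b : R) : Prop :=
  forall n : nat, a <> qw_iter q w n b /\ b <> qw_iter q w n a.

(* Main.v *)
(* Perturbing the extremal at the single point x_(m+1), where x_k is the orbit
   under t |-> qt + w of an endpoint x, changes exactly two terms of the
   Jackson-Norlund series, those at x_m and x_(m+1); by Fermat the derivative of
   this finite sum vanishes, which is the Euler-Lagrange equation at x_m.  At
   omega0 the equation follows by summing it along an orbit: the difference
   quotient of the third partial derivative between x_m and omega0 is a weighted
   mean of the values of the second one at x_k, k >= m. *)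
Require Import Defs.
From Stdlib Require Import Reals Lra Lia FunctionalExtensionality.
From Coquelicot Require Import Coquelicot.
Open Scope R_scope.

(** * Orbits of the contraction [t |-> q * t + w] towards its fixed point [omega0] *)

Lemma qw_iter_sub_omega0 (q w s : R) (n : nat) :
  q < 1 -> qw_iter q w n s - omega0 q w = q ^ n * (s - omega0 q w).
Proof. intros Hq; unfold qw_iter, qw_bracket, omega0; field; lra. Qed.

Lemma qw_iter_S (q w s : R) (n : nat) :
  q < 1 -> q * qw_iter q w n s + w = qw_iter q w (S n) s.
Proof. intros Hq; unfold qw_iter, qw_bracket; simpl; field; lra. Qed.

Lemma qw_iter_neq_omega0 (q w s : R) (n : nat) :
  0 < q < 1 -> s <> omega0 q w -> qw_iter q w n s <> omega0 q w.
Proof.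
  intros Hq Hs H.
  assert (E := qw_iter_sub_omega0 q w s n (proj2 Hq)).
  rewrite H, Rminus_diag in E.
  symmetry in E; apply Rmult_integral in E; destruct E as [E | E]; [| lra].
  apply (pow_nonzero q n) in E; lra.
Qed.

Lemma qw_shift_omega0 (q w : R) : q < 1 -> q * omega0 q w + w = omega0 q w.
Proof. intros Hq; unfold omega0; field; lra. Qed.

Lemma qw_shift_sub_omega0 (q w t : R) :
  q < 1 -> q * t + w - omega0 q w = q * (t - omega0 q w).
Proof. intros Hq; rewrite <- (qw_shift_omega0 q w Hq) at 1; ring. Qed.

Lemma qw_shift_sub (q w t : R) :
  q < 1 -> q * t + w - t = - ((1 - q) * (t - omega0 q w)).
Proof. intros Hq; generalize (qw_shift_sub_omega0 q w t Hq); lra. Qed.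

(** Distances to [omega0] scale by [q ^ m], so [m] common steps can be undone. This reduces any
    meeting of two orbits to an endpoint lying on the other orbit. *)
Lemma qw_iter_cancel (q w x y : R) (m n : nat) :
  0 < q < 1 -> qw_iter q w (m + n) x = qw_iter q w m y -> qw_iter q w n x = y.
Proof.
  intros Hq E.
  assert (H1 := qw_iter_sub_omega0 q w x (m + n) (proj2 Hq)).
  assert (H2 := qw_iter_sub_omega0 q w y m (proj2 Hq)).
  assert (H3 := qw_iter_sub_omega0 q w x n (proj2 Hq)).
  rewrite E, H2, pow_add, Rmult_assoc in H1.
  apply Rmult_eq_reg_l in H1; [lra | apply pow_nonzero; lra].
Qed.

(** A repeated value would, after cancelling common steps, make [x] periodic, while each step
    strictly shrinks its nonzero distance to [omega0]. *)
Lemma qw_iter_inj (q w x : R) (m n : nat) :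
  0 < q < 1 -> x <> omega0 q w -> qw_iter q w m x = qw_iter q w n x -> m = n.
Proof.
  intros Hq Hx.
  assert (H : forall i j, qw_iter q w (i + S j) x <> qw_iter q w i x).
  { intros i j E; apply qw_iter_cancel in E; [| exact Hq].
    assert (E' := qw_iter_sub_omega0 q w x (S j) (proj2 Hq)).
    rewrite E, <- (Rmult_1_l (x - omega0 q w)) in E' at 1.
    assert (Hlt := pow_lt_1_compat q (S j) ltac:(lra) ltac:(lia)).
    apply Rmult_eq_reg_r in E'; lra. }
  intros E; destruct (Nat.lt_trichotomy m n) as [L | [L | L]]; [exfalso | exact L | exfalso].
  - apply (H m (n - m - 1)%nat); rewrite E; f_equal; lia.
  - apply (H n (m - n - 1)%nat); rewrite <- E; f_equal; lia.
Qed.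

Lemma is_lim_seq_qw_iter (q w s : R) :
  0 < q < 1 -> is_lim_seq (fun n => qw_iter q w n s) (omega0 q w).
Proof.
  intros Hq.
  apply is_lim_seq_ext with (fun n => q ^ n * (s - omega0 q w) + omega0 q w).
  { intros n; generalize (qw_iter_sub_omega0 q w s n (proj2 Hq)); lra. }
  replace (Finite (omega0 q w)) with (Finite (0 * (s - omega0 q w) + omega0 q w))
    by (f_equal; ring).
  apply is_lim_seq_plus'; [| apply is_lim_seq_const].
  apply is_lim_seq_mult'; [| apply is_lim_seq_const].
  apply is_lim_seq_geom; rewrite Rabs_pos_eq; lra.
Qed.

Lemma qw_interval_endpoint (q w a b x : R) (n : nat) :
  x = a \/ x = b -> qw_interval q w a b (qw_iter q w n x).
Proof. intros [-> | ->]; [left | right; left]; exists n; reflexivity. Qed.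

Lemma qw_interval_cases (q w a b t : R) :
  qw_interval q w a b t ->
  t = omega0 q w \/ exists x n, (x = a \/ x = b) /\ t = qw_iter q w n x.
Proof.
  intros [[n H] | [[n H] | H]]; [right; exists a, n | right; exists b, n | left]; auto.
Qed.

Lemma qw_interval_shift (q w a b t : R) :
  q < 1 -> qw_interval q w a b t -> qw_interval q w a b (q * t + w).
Proof.
  intros Hq H; destruct (qw_interval_cases _ _ _ _ _ H) as [-> | [x [n [Hx ->]]]].
  - rewrite qw_shift_omega0; [exact H | exact Hq].
  - rewrite qw_iter_S; [apply qw_interval_endpoint; exact Hx | exact Hq].
Qed.

Lemma qw_interval_iter (q w a b t : R) (n : nat) :
  q < 1 -> qw_interval q w a b t -> qw_interval q w a b (qw_iter q w n t).
Proof.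
  intros Hq H; induction n as [| n IH].
  - replace (qw_iter q w 0 t) with t; [exact H |].
    unfold qw_iter, qw_bracket; simpl; field; lra.
  - rewrite <- qw_iter_S; [apply qw_interval_shift; assumption | exact Hq].
Qed.

(** * Uniqueness of the Hahn derivative *)

Lemma omega0_limit_point (q w a b : R) :
  0 < q < 1 -> a < b ->
  ProperFilter' (within (qw_interval q w a b) (locally' (omega0 q w))).
Proof.
  intros Hq Hab; constructor; [| do 2 apply within_filter; apply locally_filter].
  intros H.
  (* Since [a < b], at least one endpoint differs from [omega0]; its orbit converges to [omega0]
     without ever reaching it. *)
  assert (Hx : exists x, (x = a \/ x = b) /\ x <> omega0 q w).
  { destruct (Req_dec a (omega0 q w)); [exists b | exists a]; split; auto; lra. }
  destruct Hx as [x [Hx Hne]].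
  destruct (is_lim_seq_qw_iter q w x Hq _ H) as [N HN].
  apply (HN N (le_n N)); [apply qw_iter_neq_omega0 | apply qw_interval_endpoint]; assumption.
Qed.

Lemma is_derive_on_unique (q w a b : R) (y : R -> R) (l l' : R) :
  0 < q < 1 -> a < b ->
  is_derive_on (qw_interval q w a b) y (omega0 q w) l ->
  is_derive_on (qw_interval q w a b) y (omega0 q w) l' -> l = l'.
Proof.
  intros Hq Hab H1 H2.
  assert (P := omega0_limit_point q w a b Hq Hab).
  exact (filterlim_locally_unique _ _ _ H1 H2).
Qed.

Lemma hahn_derive_unique (q w a b : R) (y : R -> R) (t l : R) :
  0 < q < 1 -> a < b ->
  is_hahn_derive q w (qw_interval q w a b) y t l ->
  hahn_derive q w (qw_interval q w a b) y t = l.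
Proof.
  intros Hq Hab [H1 H2]; unfold hahn_derive.
  destruct (Req_EM_T t (omega0 q w)) as [E | E]; [| symmetry; exact (H1 E)].
  apply (@iota_unique R_AbsRing R_CompleteNormedModule); [| exact (H2 E)].
  intros l' H'; exact (is_derive_on_unique q w a b y l' l Hq Hab H' (H2 E)).
Qed.

(** Only [omega0] needs an existence hypothesis: elsewhere the Hahn derivative is a plain
    quotient. *)
Lemma hahn_derive_correct (q w a b : R) (y : R -> R) (t : R) :
  0 < q < 1 -> a < b ->
  ex_hahn_derive q w (qw_interval q w a b) y (omega0 q w) ->
  is_hahn_derive q w (qw_interval q w a b) y t
    (hahn_derive q w (qw_interval q w a b) y t).
Proof.
  intros Hq Hab [l Hl].
  destruct (Req_dec t (omega0 q w)) as [-> | E].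
  - rewrite (hahn_derive_unique q w a b y (omega0 q w) l Hq Hab Hl); exact Hl.
  - split; [intros _ | tauto].
    unfold hahn_derive; destruct (Req_EM_T t (omega0 q w)); [tauto | reflexivity].
Qed.

(** * Linearity of the Hahn derivative and of the space E *)

Lemma filterlim_plus_scal {T : Type} (F : (T -> Prop) -> Prop) {FF : Filter F}
    (u v : T -> R) (c l m : R) :
  filterlim u F (locally l) -> filterlim v F (locally m) ->
  filterlim (fun x => u x + c * v x) F (locally (l + c * m)).
Proof.
  intros Hu Hv.
  refine (filterlim_comp_2 u (fun x => c * v x) Rplus Hu _
            (@filterlim_plus R_AbsRing R_NormedModule l (c * m))).
  exact (filterlim_comp _ _ _ v (fun z => c * z) _ _ _ Hv
           (@filterlim_scal_r R_AbsRing R_NormedModule c m)).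
Qed.

Lemma is_hahn_derive_plus_scal (q w : R) (S : R -> Prop) (y h : R -> R)
    (c t l m : R) :
  is_hahn_derive q w S y t l -> is_hahn_derive q w S h t m ->
  is_hahn_derive q w S (fun t => y t + c * h t) t (l + c * m).
Proof.
  intros [Hy1 Hy2] [Hh1 Hh2]; split; intros E.
  - rewrite (Hy1 E), (Hh1 E); unfold Rdiv; ring.
  - apply filterlim_ext with
      (fun s => (y s - y (omega0 q w)) / (s - omega0 q w)
                + c * ((h s - h (omega0 q w)) / (s - omega0 q w))).
    { intros s; unfold Rdiv; ring. }
    apply filterlim_plus_scal; [do 2 apply within_filter; apply locally_filter | |];
      [exact (Hy2 E) | exact (Hh2 E)].
Qed.

Lemma hahn_derive_plus_scal (q w a b : R) (y h : R -> R) (c t : R) :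
  0 < q < 1 -> a < b -> in_E q w a b y -> in_E q w a b h ->
  hahn_derive q w (qw_interval q w a b) (fun t => y t + c * h t) t
  = hahn_derive q w (qw_interval q w a b) y t
    + c * hahn_derive q w (qw_interval q w a b) h t.
Proof.
  intros Hq Hab [_ [Hy _]] [_ [Hh _]].
  apply hahn_derive_unique; [exact Hq | exact Hab |].
  apply is_hahn_derive_plus_scal; apply hahn_derive_correct; assumption.
Qed.

Lemma in_E_plus_scal (q w a b : R) (y h : R -> R) (c : R) :
  0 < q < 1 -> a < b -> in_E q w a b y -> in_E q w a b h ->
  in_E q w a b (fun t => y t + c * h t).
Proof.
  intros Hq Hab Ey Eh.
  assert (D := fun t => hahn_derive_plus_scal q w a b y h c t Hq Hab Ey Eh).
  destruct Ey as [Hy [Dy [[M HM] Cy]]], Eh as [Hh [Dh [[N HN] Ch]]].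
  assert (FF : Filter (within (qw_interval q w a b) (locally (omega0 q w))))
    by (apply within_filter, locally_filter).
  split; [| split; [| split]].
  - exact (filterlim_plus_scal _ _ _ c _ _ Hy Hh).
  - destruct Dy as [l Hl], Dh as [m Hm]; exists (l + c * m).
    apply is_hahn_derive_plus_scal; assumption.
  - exists (M + Rabs c * N); intros t Ht; rewrite D.
    eapply Rle_trans; [apply Rabs_triang |].
    apply Rplus_le_compat; [exact (HM t Ht) |].
    rewrite Rabs_mult; apply Rmult_le_compat_l; [apply Rabs_pos | exact (HN t Ht)].
  - unfold continuous_on_at; rewrite D.
    eapply filterlim_ext; [intros t; symmetry; apply D |].
    exact (filterlim_plus_scal _ _ _ c _ _ Cy Ch).
Qed.

Lemma admissible_plus_scal (q w a b alpha beta : R) (y h : R -> R) (c : R) :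
  0 < q < 1 -> a < b ->
  admissible q w a b alpha beta y -> admissible_variation q w a b h ->
  admissible q w a b alpha beta (fun t => y t + c * h t).
Proof.
  intros Hq Hab [Ey [Ha Hb]] [Eh [Ha' Hb']]; split; [| split].
  - apply in_E_plus_scal; assumption.
  - rewrite Ha, Ha'; ring.
  - rewrite Hb, Hb'; ring.
Qed.

(** Identifies the integrand of the functional at [y + c h] with the function [g] of assumption
    (3). *)
Lemma along_plus_scal (q w a b : R) (f : R -> R -> R -> R) (y h : R -> R) (c t : R) :
  0 < q < 1 -> a < b -> in_E q w a b y -> in_E q w a b h ->
  along q w a b f (fun t => y t + c * h t) t = variation_fun q w a b f y h t c.
Proof.
  intros Hq Hab Ey Eh; unfold along, variation_fun.
  rewrite hahn_derive_plus_scal; auto.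
Qed.

(** * Variations concentrated at a single point *)

Definition spike (p t : R) : R := if Req_EM_T t p then 1 else 0.

Lemma spike_self (p : R) : spike p p = 1.
Proof. unfold spike; destruct (Req_EM_T p p); tauto. Qed.

Lemma spike_neq (p t : R) : t <> p -> spike p t = 0.
Proof. intros H; unfold spike; destruct (Req_EM_T t p); tauto. Qed.

Lemma spike_bounded (p t : R) : Rabs (spike p t) <= 1.
Proof.
  unfold spike; destruct (Req_EM_T t p); rewrite Rabs_pos_eq; lra.
Qed.

Lemma locally_neq (p x : R) : x <> p -> locally x (fun t => t <> p).
Proof.
  intros H; apply (open_comp (fun t => t) (fun t => t <> p)); auto using open_neq.
  intros; apply filterlim_id.
Qed.

Lemma is_hahn_derive_spike_omega0 (q w p : R) (S : R -> Prop) :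
  p <> omega0 q w -> is_hahn_derive q w S (spike p) (omega0 q w) 0.
Proof.
  intros Hp; split; [tauto | intros _].
  apply filterlim_ext_loc with (fun _ => 0); [| apply filterlim_const].
  unfold locally', within.
  generalize (locally_neq p (omega0 q w) (not_eq_sym Hp)); apply filter_imp.
  intros t Ht _ _; rewrite !spike_neq; auto; unfold Rdiv; ring.
Qed.

Lemma hahn_derive_spike_away (q w a b p t : R) :
  0 < q < 1 -> a < b -> p <> omega0 q w -> t <> p -> q * t + w <> p ->
  hahn_derive q w (qw_interval q w a b) (spike p) t = 0.
Proof.
  intros Hq Hab Hp H1 H2; destruct (Req_dec t (omega0 q w)) as [-> | E].
  - apply hahn_derive_unique; auto using is_hahn_derive_spike_omega0.
  - unfold hahn_derive; destruct (Req_EM_T t (omega0 q w)); [tauto |].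
    rewrite !spike_neq; auto; unfold Rdiv; ring.
Qed.

(** The spike and its Hahn derivative vanish near [omega0], which settles continuity there. The
    derivative can be nonzero only at [p] and at the preimage of [p] under the shift, where the step
    [q * t + w - t] stays away from 0. *)
Lemma in_E_spike (q w a b p : R) :
  0 < q < 1 -> a < b -> p <> omega0 q w -> in_E q w a b (spike p).
Proof.
  intros Hq Hab Hp.
  assert (Hs := is_hahn_derive_spike_omega0 q w p (qw_interval q w a b) Hp).
  assert (Hloc := locally_neq p (omega0 q w) (not_eq_sym Hp)).
  split; [| split; [| split]].
  - unfold in_D, continuous_on_at; rewrite spike_neq; auto.
    apply filterlim_ext_loc with (fun _ => 0); [| apply filterlim_const].
    unfold within; revert Hloc; apply filter_imp; intros t Ht _; rewrite spike_neq; auto.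
  - exists 0; exact Hs.
  - assert (Hd : 0 < Rabs (p - omega0 q w)) by (apply Rabs_pos_lt; lra).
    assert (H0 : 0 < / ((1 - q) * Rabs (p - omega0 q w)))
      by (apply Rinv_0_lt_compat, Rmult_lt_0_compat; lra).
    exists (/ ((1 - q) * Rabs (p - omega0 q w))); intros t _.
    (* The numerator of the quotient has modulus at most 1, and its denominator has modulus
       [(1 - q) * Rabs (t - omega0 q w)]. *)
    assert (Hfar : Rabs (p - omega0 q w) <= Rabs (t - omega0 q w) ->
      Rabs (hahn_derive q w (qw_interval q w a b) (spike p) t)
      <= / ((1 - q) * Rabs (p - omega0 q w))).
    { intros Ht; unfold hahn_derive; destruct (Req_EM_T t (omega0 q w)) as [E | _].
      { rewrite E, Rminus_diag, Rabs_R0 in Ht; lra. }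
      unfold Rdiv; rewrite Rabs_mult, Rabs_inv, qw_shift_sub, Rabs_Ropp, Rabs_mult,
        (Rabs_pos_eq (1 - q)) by lra.
      rewrite <- (Rmult_1_l (/ ((1 - q) * Rabs (p - omega0 q w)))).
      apply Rmult_le_compat; [apply Rabs_pos | | |].
      - left; apply Rinv_0_lt_compat; nra.
      - unfold spike; destruct (Req_EM_T (q * t + w) p), (Req_EM_T t p);
          unfold Rabs; destruct Rcase_abs; lra.
      - apply Rinv_le_contravar; nra. }
    destruct (Req_dec t p) as [Et | Et].
    { apply Hfar; rewrite Et; apply Rle_refl. }
    (* The preimage of [p] is farther from [omega0] than [p], by the factor [1 / q]. *)
    destruct (Req_dec (q * t + w) p) as [Es | Es].
    { apply Hfar; rewrite <- Es, qw_shift_sub_omega0, Rabs_mult, (Rabs_pos_eq q) by lra.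
      generalize (Rabs_pos (t - omega0 q w)); nra. }
    rewrite hahn_derive_spike_away, Rabs_R0 by assumption; lra.
  - unfold continuous_on_at; rewrite (hahn_derive_unique q w a b _ _ _ Hq Hab Hs).
    apply filterlim_ext_loc with (fun _ => 0); [| apply filterlim_const].
    assert (Hloc' : locally (omega0 q w) (fun t => q * t + w <> p)).
    (* [(p - w) / q] is the preimage of [p]; it is not [omega0], a fixed point of the shift. *)
    { assert (Hne : omega0 q w <> (p - w) / q).
      { intros E; apply Hp; rewrite <- (qw_shift_omega0 q w (proj2 Hq)), E; field; lra. }
      assert (Heq : forall t : R, q * t + w = p -> t = (p - w) / q)
        by (intros t <-; field; lra).
      generalize (locally_neq _ _ Hne); apply filter_imp.
      intros t Ht E; exact (Ht (Heq t E)). }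
    unfold within; generalize (filter_and _ _ Hloc Hloc'); apply filter_imp.
    intros t [H1 H2] _; symmetry; apply hahn_derive_spike_away; assumption.
Qed.

(** * The norm of E and the vanishing of the first variation *)

Lemma sup_on_le (S : R -> Prop) (y : R -> R) (M : R) :
  (forall t, S t -> Rabs (y t) <= M) -> Rbar_le (sup_on S y) M.
Proof.
  intros H; apply (proj2 (Lub_Rbar_correct _)); intros r [t [Ht ->]]; exact (H t Ht).
Qed.

Lemma norm1_le (q w a b : R) (y : R -> R) (M N : R) :
  (forall t, qw_interval q w a b t -> Rabs (y t) <= M) ->
  (forall t, qw_interval q w a b t ->
     Rabs (hahn_derive q w (qw_interval q w a b) y t) <= N) ->
  Rbar_le (norm1 q w a b y) (M + N).
Proof.
  intros HM HN; exact (Rbar_plus_le_compat _ _ _ _ (sup_on_le _ _ _ HM) (sup_on_le _ _ _ HN)).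
Qed.

(** Fermat's theorem on the line [y + e h]: for small [e] these functions are admissible and close
    to [y] in norm, so [e = 0] is a local extremum of a real function. *)
Lemma first_variation_zero (q w a b alpha beta : R) (f : R -> R -> R -> R)
    (y h : R -> R) (N l : R) :
  0 < q < 1 -> a < b ->
  local_minimizer q w a b alpha beta f y \/
  local_maximizer q w a b alpha beta f y ->
  admissible_variation q w a b h ->
  (forall t, qw_interval q w a b t -> Rabs (h t) <= N) ->
  is_derive (fun e => functional q w a b f (fun t => y t + e * h t)) 0 l ->
  l = 0.
Proof.
  intros Hq Hab Hext Hh HN Hder.
  assert (Hy : admissible q w a b alpha beta y)
    by (destruct Hext as [[H _] | [H _]]; exact H).
  assert (Eh := proj1 Hh).
  assert (Hbd := Eh); destruct Hbd as [_ [_ [[M HM] _]]].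
  assert (Hw : qw_interval q w a b (omega0 q w)) by (right; right; reflexivity).
  assert (HN0 := Rle_trans _ _ _ (Rabs_pos _) (HN _ Hw)).
  assert (HM0 := Rle_trans _ _ _ (Rabs_pos _) (HM _ Hw)).
  (* The norm of [e h] is at most [Rabs e * (N + M)]; the extra 1 keeps the denominator positive
     when [N] and [M] are both 0. *)
  assert (Hsmall : forall delta : posreal, forall e : R,
    - (delta / (N + M + 1)) < e -> e < delta / (N + M + 1) ->
    Rbar_lt (norm1 q w a b (fun t => y t + e * h t - y t)) delta).
  { intros delta e He1 He2.
    assert (He : Rabs e * (N + M + 1) < delta).
    { apply (Rmult_lt_reg_r (/ (N + M + 1))); [apply Rinv_0_lt_compat; lra |].
      rewrite Rmult_assoc, Rinv_r, Rmult_1_r by lra.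
      apply Rabs_def1; [exact He2 | exact He1]. }
    (* Writing [e h] as [h + (e - 1) h] lets [hahn_derive_plus_scal] compute its derivative. *)
    replace (fun t => y t + e * h t - y t) with (fun t => h t + (e - 1) * h t)
      by (apply functional_extensionality; intros t; ring).
    apply Rbar_le_lt_trans with (Finite (Rabs e * N + Rabs e * M)).
    2: simpl; generalize (Rabs_pos e); lra.
    apply norm1_le; intros t Ht.
    - replace (h t + (e - 1) * h t) with (e * h t) by ring.
      rewrite Rabs_mult; apply Rmult_le_compat_l; [apply Rabs_pos | exact (HN t Ht)].
    - rewrite hahn_derive_plus_scal by assumption.
      set (d := hahn_derive _ _ _ _ _).
      replace (d + (e - 1) * d) with (e * d) by ring.
      rewrite Rabs_mult; apply Rmult_le_compat_l; [apply Rabs_pos | exact (HM t Ht)]. }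
  assert (H0 : (fun t => y t + 0 * h t) = y)
    by (apply functional_extensionality; intros t; ring).
  apply is_derive_Reals in Hder.
  pose (pr := exist _ l Hder : derivable_pt _ 0).
  change (derive_pt _ 0 pr = 0).
  destruct Hext as [[_ [delta Hd]] | [_ [delta Hd]]];
    assert (Hpos : 0 < delta / (N + M + 1))
      by (apply Rdiv_lt_0_compat; [apply cond_pos | lra]).
  - apply deriv_minimum with (- (delta / (N + M + 1))) (delta / (N + M + 1)); try lra.
    intros e He1 He2; rewrite H0; apply Hd;
      [apply admissible_plus_scal | apply Hsmall]; assumption.
  - apply deriv_maximum with (- (delta / (N + M + 1))) (delta / (N + M + 1)); try lra.
    intros e He1 He2; rewrite H0; apply Rge_le, Hd;
      [apply admissible_plus_scal | apply Hsmall]; assumption.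
Qed.

(** * Derivative of the perturbed integrand, and series differing in two terms *)

Lemma is_derive_variation_fun (q w a b : R) (f : R -> R -> R -> R)
    (y h : R -> R) (t : R) :
  C1_R2 (f t) ->
  is_derive (variation_fun q w a b f y h t) 0
    (along q w a b (partial2 f) y t * h (q * t + w)
     + along q w a b (partial3 f) y t
       * hahn_derive q w (qw_interval q w a b) h t).
Proof.
  intros [Hd Hc]; apply is_derive_Reals; unfold variation_fun, along.
  set (u := y _); set (u' := h _); set (v := hahn_derive _ _ _ y _);
    set (v' := hahn_derive _ _ _ h _).
  assert (Hlin : forall z z' : R, derivable_pt_lim (fun e => z + e * z') 0 z').
  { intros z z'; apply is_derive_Reals; auto_derive; [exact I | ring]. }
  apply (derivable_pt_lim_comp_2d (f t)); [| apply Hlin | apply Hlin].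
  rewrite !Rmult_0_l, !Rplus_0_r.
  apply filterdiff_differentiable_pt_lim.
  (* Joint differentiability follows from one partial derivative existing nearby and being
     continuous at the point, and the other existing at the point. *)
  apply (is_derive_filterdiff (f t) u v (fun x z => Derive (fun x => f t x z) x)).
  - apply filter_forall; intros [x z]; apply Derive_correct, Hd.
  - apply Derive_correct, Hd.
  - apply (Hc (u, v)).
Qed.

Lemma Series_eq_except_pair (u v : nat -> R) (m : nat) :
  ex_series u -> ex_series v ->
  (forall k, k <> m -> k <> S m -> u k = v k) ->
  Series u = Series v + (u m - v m) + (u (S m) - v (S m)).
Proof.
  revert u v; induction m as [| m IH]; intros u v Hu Hv H;
    assert (Hu' := proj1 (ex_series_incr_1 u) Hu);
    assert (Hv' := proj1 (ex_series_incr_1 v) Hv);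
    rewrite (Series_incr_1 u Hu), (Series_incr_1 v Hv).
  - rewrite (Series_incr_1 _ Hu'), (Series_incr_1 _ Hv').
    rewrite (Series_ext (fun k => u (S (S k))) (fun k => v (S (S k)))); [ring |].
    intros k; apply H; lia.
  - rewrite (IH _ _ Hu' Hv') by (intros k Hk1 Hk2; apply H; lia).
    rewrite (H 0%nat) by lia; ring.
Qed.

(** * The Euler-Lagrange equation at the points of an orbit *)

Lemma ex_jn_int0_along (q w a b alpha beta : R) (f : R -> R -> R -> R)
    (y : R -> R) (x : R) :
  0 < q < 1 -> a < b -> x = a \/ x = b ->
  assumption3 q w a b alpha beta f -> admissible q w a b alpha beta y ->
  ex_jn_int0 q w (along q w a b f y) x.
Proof.
  intros Hq Hab Hx H3 Hy.
  (* Assumption (3) gives convergence only for a pair [y], [h]; any admissible variation will do,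
     taken at parameter 0. A spike to the right of [b] and [omega0] is one. *)
  assert (Hne : exists p, p <> omega0 q w /\ a <> p /\ b <> p).
  { exists (Rmax (omega0 q w) b + 1).
    generalize (Rmax_l (omega0 q w) b) (Rmax_r (omega0 q w) b); lra. }
  destruct Hne as [p [Hp [Hpa Hpb]]].
  assert (Hh : admissible_variation q w a b (spike p))
    by (split; [apply in_E_spike | split; apply spike_neq]; assumption).
  destruct (H3 y (spike p) Hy Hh) as [_ [_ [Hloc _]]].
  destruct (locally_singleton _ _ Hloc) as [Ha Hb].
  assert (Hext : forall t, variation_fun q w a b f y (spike p) t 0 = along q w a b f y t)
    by (intros t; unfold variation_fun, along; rewrite !Rmult_0_l, !Rplus_0_r; reflexivity).
  destruct Hx as [-> | ->]; [revert Ha | revert Hb]; apply ex_series_ext;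
    intros k; rewrite Hext; reflexivity.
Qed.

Lemma jn_node (q w x : R) (k : nat) : x * q ^ k + qw_bracket q w k = qw_iter q w k x.
Proof. unfold qw_iter; ring. Qed.

(* The variation concentrated at the node [qw_iter q w (S m) x] only changes the
   terms [m] and [S m] of the series at [x], and none of the series at [x']. *)
Lemma euler_lagrange_node (q w a b alpha beta : R) (f : R -> R -> R -> R)
    (y : R -> R) (x x' : R) (m : nat) :
  0 < q < 1 -> a < b -> distinct_orbits q w a b ->
  (x = a /\ x' = b) \/ (x = b /\ x' = a) ->
  x <> omega0 q w ->
  assumption1 q w a b f -> assumption3 q w a b alpha beta f ->
  local_minimizer q w a b alpha beta f y \/
  local_maximizer q w a b alpha beta f y ->
  hahn_derive q w (qw_interval q w a b) (along q w a b (partial3 f) y) (qw_iter q w m x)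
  = along q w a b (partial2 f) y (qw_iter q w m x).
Proof.
  intros Hq Hab Hdist Hxx Hx H1 H3 Hext.
  assert (Hy : admissible q w a b alpha beta y)
    by (destruct Hext as [[H _] | [H _]]; exact H).
  set (S0 := qw_interval q w a b).
  assert (HxS : x = a \/ x = b) by tauto.
  set (X k := qw_iter q w k x).
  assert (HX : forall k, q * X k + w = X (S k)) by (intros k; apply qw_iter_S; lra).
  assert (HX0 : forall k, X k <> omega0 q w)
    by (intros k; apply qw_iter_neq_omega0; assumption).
  assert (HXinj : forall i j, X i = X j -> i = j)
    by (intros i j; apply qw_iter_inj; assumption).
  (* If the orbits met, cancelling the smaller number of steps would put one endpoint on the orbit
     of the other, against [distinct_orbits]. *)
  assert (HXX : forall i j, qw_iter q w i x' <> X j).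
  { assert (Hd : forall n, x <> qw_iter q w n x' /\ x' <> qw_iter q w n x)
      by (intros n; destruct (Hdist n); destruct Hxx as [[-> ->] | [-> ->]]; auto).
    intros i j E; destruct (Nat.le_ge_cases i j) as [L | L].
    - apply (proj2 (Hd (j - i)%nat)); symmetry; apply (qw_iter_cancel q w x x' i); [exact Hq |].
      replace (i + (j - i))%nat with j by lia; symmetry; exact E.
    - apply (proj1 (Hd (i - j)%nat)); symmetry; apply (qw_iter_cancel q w x' x j); [exact Hq |].
      replace (j + (i - j))%nat with i by lia; exact E. }
  assert (HX0' : forall z, qw_iter q w 0 z = z)
    by (intros z; unfold qw_iter, qw_bracket; simpl; field; lra).
  set (p := X (S m)); set (h := spike p).
  assert (Hp : p <> omega0 q w) by apply HX0.
  assert (Hpx : x <> p).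
  { intros E; assert (X 0%nat = X (S m)) by (unfold X at 1; rewrite HX0'; exact E).
    apply HXinj in H; discriminate. }
  assert (Hpx' : x' <> p) by (rewrite <- (HX0' x'); apply HXX).
  assert (Hh : admissible_variation q w a b h).
  { split; [apply in_E_spike; assumption |].
    split; apply spike_neq; destruct Hxx as [[<- <-] | [<- <-]]; assumption. }
  set (g := variation_fun q w a b f y h).
  assert (Hg : forall e t, along q w a b f (fun t => y t + e * h t) t = g t e)
    by (intros e t; apply along_plus_scal; try assumption; [apply Hy | apply Hh]).
  (* The integrand sees the spike only at [p] itself and at the point shifted onto [p], that is at
     [X (S m)] and [X m]. *)
  assert (Haway : forall t e, t <> p -> q * t + w <> p -> g t e = g t 0).
  { intros t e Ht Hs; unfold g, variation_fun, h.
    rewrite spike_neq, hahn_derive_spike_away by assumption.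
    rewrite !Rmult_0_r; reflexivity. }
  set (K := x * (1 - q) - w).
  set (psi e := q ^ m * g (X m) e + q ^ S m * g (X (S m)) e).
  (* Convergence holds for every [e], not just small ones, because each [y + e h] is itself
     admissible. *)
  assert (Hex : forall e, ex_series (fun k => q ^ k * g (X k) e)).
  { intros e.
    assert (E := ex_jn_int0_along q w a b alpha beta f _ x Hq Hab HxS H3
                   (admissible_plus_scal q w a b alpha beta y h e Hq Hab Hy Hh)).
    revert E; apply ex_series_ext; intros k; rewrite Hg, jn_node; reflexivity. }
  assert (Hint : forall e, jn_int0 q w (along q w a b f (fun t => y t + e * h t)) x
    = K * Series (fun k => q ^ k * g (X k) 0) + K * (psi e - psi 0)).
  { intros e; unfold jn_int0; fold K; rewrite <- Rmult_plus_distr_l; f_equal.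
    rewrite (Series_ext _ (fun k => q ^ k * g (X k) e))
      by (intros k; rewrite Hg, jn_node; reflexivity).
    rewrite (Series_eq_except_pair _ _ m (Hex e) (Hex 0)); [unfold psi; ring |].
    intros k Hk1 Hk2; f_equal; apply Haway; [| rewrite HX]; intros E;
      apply HXinj in E; lia. }
  assert (Hint' : forall e, jn_int0 q w (along q w a b f (fun t => y t + e * h t)) x'
    = (x' * (1 - q) - w) * Series (fun k => q ^ k * g (qw_iter q w k x') 0)).
  { intros e; unfold jn_int0; f_equal; apply Series_ext; intros k.
    rewrite Hg, jn_node; f_equal; apply Haway; [| rewrite qw_iter_S by lra]; apply HXX. }
  set (P2 := along q w a b (partial2 f) y); set (P3 := along q w a b (partial3 f) y).
  set (l := q ^ m * (P2 (X m) * h (X (S m)) + P3 (X m) * hahn_derive q w S0 h (X m))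
            + q ^ S m * (P2 (X (S m)) * h (X (S (S m)))
                         + P3 (X (S m)) * hahn_derive q w S0 h (X (S m)))).
  assert (Hpsi : is_derive psi 0 l).
  { assert (Hgk : forall k, is_derive (g (X k)) 0
      (P2 (X k) * h (X (S k)) + P3 (X k) * hahn_derive q w S0 h (X k))).
    { intros k; rewrite <- (HX k); apply is_derive_variation_fun.
      apply H1, qw_interval_endpoint; assumption. }
    apply (is_derive_plus (fun e => q ^ m * g (X m) e) (fun e => q ^ S m * g (X (S m)) e));
      apply is_derive_scal, Hgk. }
  assert (HK : K <> 0).
  { unfold K; replace (x * (1 - q) - w) with ((1 - q) * (x - omega0 q w))
      by (unfold omega0; field; lra).
    apply Rmult_integral_contrapositive; lra. }
  assert (Hl : l = 0).
  (* The factor [s] is [K] when [x] is the upper endpoint [b] and [- K] when it is [a]; everything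
     independent of [e] goes into [c]. *)
  { assert (Hsgn : exists s c, s <> 0 /\
      forall e, functional q w a b f (fun t => y t + e * h t) = s * psi e + c).
    { unfold functional, jn_int.
      set (A := Series _) in Hint; set (B := _ * Series _) in Hint'.
      destruct Hxx as [[<- <-] | [<- <-]].
      - exists (- K), (B - K * A + K * psi 0); split; [lra |].
        intros e; rewrite Hint, Hint'; ring.
      - exists K, (K * A - K * psi 0 - B); split; [exact HK |].
        intros e; rewrite Hint, Hint'; ring. }
    destruct Hsgn as [s [c [Hs Hfun]]].
    assert (E : s * l = 0).
    { apply (first_variation_zero q w a b alpha beta f y h 1); try assumption.
      - intros t _; apply spike_bounded.
      - apply is_derive_ext with (fun e => s * psi e + c); [intros e; symmetry; apply Hfun |].
        replace (s * l) with (plus (s * l) 0) by (unfold plus; simpl; ring).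
        apply (is_derive_plus (fun e => s * psi e) (fun _ => c));
          [apply is_derive_scal, Hpsi | apply @is_derive_const]. }
    apply Rmult_integral in E; tauto. }
  (* The orbit steps are, up to sign, the weights of the Jackson-Norlund series, so each weight
     cancels the denominator of the Hahn derivative of the spike. *)
  assert (Hd : forall k, X (S k) - X k = - (q ^ k * K)).
  { intros k; rewrite <- HX; rewrite qw_shift_sub by lra.
    unfold X; rewrite qw_iter_sub_omega0 by lra; unfold K, omega0; field; lra. }
  assert (Hhahn : forall z k, hahn_derive q w S0 z (X k) = (z (X (S k)) - z (X k)) / (X (S k) - X k)).
  { intros z k; unfold hahn_derive; rewrite HX.
    destruct (Req_EM_T (X k) (omega0 q w)) as [E | _]; [destruct (HX0 k E) | reflexivity]. }
  assert (Hneq : forall i j, i <> j -> X i <> X j) by (intros i j Hij E; exact (Hij (HXinj i j E))).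
  change (hahn_derive q w S0 P3 (X m) = P2 (X m)).
  unfold l in Hl; rewrite !Hhahn, !Hd in Hl; rewrite Hhahn, Hd.
  unfold h in Hl; fold p in Hl; rewrite spike_self in Hl.
  rewrite !spike_neq in Hl by (apply Hneq; lia); fold p.
  assert (Hqm : q ^ m <> 0) by (apply pow_nonzero; lra).
  (* After this scaling, the left side minus the right side is exactly [- K * l]. *)
  apply (Rmult_eq_reg_l (q ^ m * K)); [| apply Rmult_integral_contrapositive; tauto].
  simpl in Hl.
  apply Rminus_diag_uniq; transitivity (- K * 0); [rewrite <- Hl | ring].
  field; repeat split; try assumption; lra.
Qed.

(** * Differentiability at [omega0] *)

(* A function whose increments along [t |-> q t + w] are nearly [L] times the
   steps has, by telescoping down to [omega0], difference quotient near [L]. *)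
Lemma is_derive_on_of_shift (q w a b : R) (G : R -> R) (psi : R -> R) :
  0 < q < 1 ->
  let S := qw_interval q w a b in
  continuous_on_at S G (omega0 q w) ->
  continuous_on_at S psi (omega0 q w) ->
  (forall t, S t -> t <> omega0 q w ->
     G (q * t + w) - G t = psi t * (q * t + w - t)) ->
  is_derive_on S G (omega0 q w) (psi (omega0 q w)).
Proof.
  intros Hq S CG Cpsi Hstep.
  set (o := omega0 q w) in *; set (L := psi o).
  apply filterlim_locally; intros eps.
  assert (Heps : 0 < eps / 2) by (generalize (cond_pos eps); lra).
  destruct (proj1 (filterlim_locally _ _) Cpsi (mkposreal _ Heps)) as [d Hd].
  (* The radius from the continuity of [psi] serves unchanged, since the whole orbit of [t] stays at
     least as close to [omega0] as [t]. *)
  exists d; refine (fun (t : R) Ht Hto HtS => _).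
  assert (Hclose : forall n, Rabs (qw_iter q w n t - o) <= Rabs (t - o)).
  { intros n; unfold o; rewrite qw_iter_sub_omega0, Rabs_mult by lra.
    assert (Hqn := pow_le q n ltac:(lra)).
    assert (Hqn1 : q ^ n <= 1) by (rewrite <- (pow1 n); apply pow_incr; lra).
    rewrite (Rabs_pos_eq (q ^ n)) by exact Hqn.
    generalize (Rabs_pos (t - omega0 q w)); nra. }
  assert (HS : forall n, S (qw_iter q w n t))
    by (intros n; apply qw_interval_iter; [lra | exact HtS]).
  (* The step lengths [(1 - q) * q ^ k * Rabs (t - o)] for [k < n] add up to
     [(1 - q ^ n) * Rabs (t - o)], and each contributes an error of at most [eps / 2] times its
     length. *)
  assert (Hinc : forall n,
    Rabs (G (qw_iter q w n t) - G t - L * (qw_iter q w n t - t))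
    <= eps / 2 * ((1 - q ^ n) * Rabs (t - o))).
  { induction n as [| n IH].
    - replace (qw_iter q w 0 t) with t
        by (unfold qw_iter, qw_bracket; simpl; field; lra).
      simpl; replace (G t - G t - L * (t - t)) with 0 by ring.
      rewrite Rabs_R0; lra.
    - set (z := qw_iter q w n t) in *.
      assert (Hz : Rabs (psi z - L) <= eps / 2).
      { left; apply (Hd z); [| apply HS].
        exact (Rle_lt_trans _ _ _ (Hclose n) Ht). }
      assert (Hs := Hstep z (HS n) (qw_iter_neq_omega0 q w t n Hq Hto)).
      rewrite <- qw_iter_S by lra; fold z.
      replace (G (q * z + w) - G t - L * (q * z + w - t))
        with ((psi z - L) * (q * z + w - z) + (G z - G t - L * (z - t)))
        by (replace (G (q * z + w)) with (psi z * (q * z + w - z) + G z) by lra; ring).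
      eapply Rle_trans; [apply Rabs_triang |].
      replace (eps / 2 * ((1 - q ^ Datatypes.S n) * Rabs (t - o)))
        with (eps / 2 * ((1 - q) * (q ^ n * Rabs (t - o)))
              + eps / 2 * ((1 - q ^ n) * Rabs (t - o))) by (simpl; ring).
      apply Rplus_le_compat; [| exact IH].
      rewrite Rabs_mult; apply Rmult_le_compat; try apply Rabs_pos; [exact Hz |].
      unfold z; rewrite qw_shift_sub, qw_iter_sub_omega0 by lra.
      rewrite Rabs_Ropp, !Rabs_mult, (Rabs_pos_eq (1 - q)), (Rabs_pos_eq (q ^ n));
        [apply Rle_refl | apply pow_le; lra | lra]. }
  assert (Hlim : is_lim_seq (fun n => qw_iter q w n t) o) by (apply is_lim_seq_qw_iter; exact Hq).
  (* Continuity of [G] is known only along [S]; the orbit of [t] stays in [S]. *)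
  assert (HlimG : is_lim_seq (fun n => G (qw_iter q w n t)) (G o)).
  { intros P HP; destruct (Hlim _ (CG P HP)) as [N HN].
    exists N; intros n Hn; exact (HN n Hn (HS n)). }
  assert (Hto' : t - o <> 0) by exact (Rminus_eq_contra _ _ Hto).
  assert (Habs := Rabs_pos_lt _ Hto').
  assert (Hle : Rabs (G o - G t - L * (o - t)) <= eps / 2 * Rabs (t - o)).
  { apply (is_lim_seq_le
      (fun n => Rabs (G (qw_iter q w n t) - G t - L * (qw_iter q w n t - t)))
      (fun _ => eps / 2 * Rabs (t - o))
      (Rabs (G o - G t - L * (o - t))) (eps / 2 * Rabs (t - o))).
    - intros n; eapply Rle_trans; [apply Hinc |].
      apply Rmult_le_compat_l; [lra |].
      generalize (pow_le q n ltac:(lra)); nra.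
    - apply (is_lim_seq_abs _ (Finite _)).
      apply is_lim_seq_minus'; [apply is_lim_seq_minus'; [exact HlimG | apply is_lim_seq_const] |].
      apply is_lim_seq_mult'; [apply is_lim_seq_const |].
      apply is_lim_seq_minus'; [exact Hlim | apply is_lim_seq_const].
    - apply is_lim_seq_const. }
  change (Rabs ((G t - G o) / (t - o) - L) < eps).
  replace ((G t - G o) / (t - o) - L) with (- (G o - G t - L * (o - t)) / (t - o))
    by (field; exact Hto').
  unfold Rdiv; rewrite Rabs_mult, Rabs_Ropp, Rabs_inv.
  apply (Rmult_lt_reg_r (Rabs (t - o))); [exact Habs |].
  rewrite Rmult_assoc, Rinv_l, Rmult_1_r by lra.
  generalize (cond_pos eps); nra.
Qed.

(** * The Euler-Lagrange equation on the whole set *)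

Theorem theorem3p2 :
  forall (q w : R) (I : R -> Prop) (a b alpha beta : R)
         (f : R -> R -> R -> R) (ytil : R -> R),
    0 < q < 1 ->
    0 < w ->
    closed_interval I ->
    I (omega0 q w) ->
    I a ->
    I b ->
    a < b ->
    distinct_orbits q w a b ->
    assumption1 q w a b f ->
    assumption2 q w a b alpha beta f ->
    assumption3 q w a b alpha beta f ->
    local_minimizer q w a b alpha beta f ytil \/
    local_maximizer q w a b alpha beta f ytil ->
    forall t : R, qw_interval q w a b t ->
      ex_hahn_derive q w (qw_interval q w a b)
        (along q w a b (partial3 f) ytil) t /\
      hahn_derive q w (qw_interval q w a b)
        (along q w a b (partial3 f) ytil) t
      = along q w a b (partial2 f) ytil t.
Proof.
  intros q w _ a b alpha beta f y Hq _ _ _ _ _ Hab Hdist H1 H2 H3 Hext t Ht.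
  assert (Hy : admissible q w a b alpha beta y)
    by (destruct Hext as [[H _] | [H _]]; exact H).
  assert (EL : forall s, qw_interval q w a b s -> s <> omega0 q w ->
    hahn_derive q w (qw_interval q w a b) (along q w a b (partial3 f) y) s
    = along q w a b (partial2 f) y s).
  { intros s Hs Hne.
    destruct (qw_interval_cases _ _ _ _ _ Hs) as [E | [x [n [Hx ->]]]]; [tauto |].
    assert (Hx0 : x <> omega0 q w).
    { intros E; apply Hne; rewrite E.
      generalize (qw_iter_sub_omega0 q w (omega0 q w) n (proj2 Hq)); lra. }
    destruct Hx as [Hx | Hx];
      [apply (euler_lagrange_node q w a b alpha beta f y x b)
      | apply (euler_lagrange_node q w a b alpha beta f y x a)]; auto. }
  destruct (H2 y Hy) as [_ [C2 C3]].
  assert (D0 : is_hahn_derive q w (qw_interval q w a b)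
    (along q w a b (partial3 f) y) (omega0 q w)
    (along q w a b (partial2 f) y (omega0 q w))).
  { split; [tauto | intros _].
    (* Here [psi] is the second partial derivative along [y]: the equation off [omega0], cleared of
       its denominator, is the increment hypothesis, and assumption (2) supplies both
       continuities. *)
    apply is_derive_on_of_shift; auto.
    intros s Hs Hne; rewrite <- (EL s Hs Hne); unfold hahn_derive.
    destruct (Req_EM_T s (omega0 q w)); [tauto |].
    field; rewrite qw_shift_sub by lra.
    apply Ropp_neq_0_compat, Rmult_integral_contrapositive; lra. }
  split.
  - eexists; apply hahn_derive_correct; auto; eexists; exact D0.
  - destruct (Req_dec t (omega0 q w)) as [-> | Hne]; [| exact (EL t Ht Hne)].
    exact (hahn_derive_unique _ _ _ _ _ _ _ Hq Hab D0).
Qed.
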